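(* Let $G$ be a finite simple graph that is a König–Egerváry graph. Then \[ d(G)=|\mathrm{core}(G)|-|N(\mathrm{core}(G))|=\alpha(G)-\mu(G)=\mathrm{def}(G). \]
   Context: A set of vertices is independent if no two of its vertices are adjacent; $\mathrm{Ind}(G)$ is the family of independent sets of $G$, $\alpha(G)$ is the maximum size of an independent set, and $\Omega(G)$ is the family of independent sets of size $\alpha(G)$. $\mathrm{core}(G)=\bigcap\{S : S\in\Omega(G)\}$. For $A\subseteq V(G)$, $N(A)$ is the set of vertices adjacent to some vertex of $A$. $\mu(G)$ is the size of a maximum matching of $G$. $G$ is a König–Egerváry graph if $\alpha(G)+\mu(G)=|V(G)|$. The critical difference is $d(G)=\max\{|S|-|N(S)| : S\in\mathrm{Ind}(G)\}$. The deficiency is $\mathrm{def}(G)=|V(G)|-2\mu(G)$. *)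

(* Defs.v *)
From mathcomp Require Import all_boot all_order all_algebra.

Set Implicit Arguments.
Unset Strict Implicit.
Unset Printing Implicit Defensive.

Import Order.TTheory GRing.Theory Num.Theory.

(* A finite simple graph on the vertex type T is given by its adjacency
   relation e : rel T, assumed symmetric and irreflexive. *)
Section Graph.
Variables (T : finType) (e : rel T).
Implicit Types (A S : {set T}) (M : {set {set T}}).

Definition independent S : bool :=
  [forall x in S, forall y in S, ~~ e x y].

Definition alpha : nat := \max_(S : {set T} | independent S) #|S|.

Definition Omega : {set {set T}} :=
  [set S : {set T} | independent S & #|S| == alpha].

Definition core : {set T} := \bigcap_(S in Omega) S.

(* Open neighbourhood: N(A) may meet A when A is not independent. *)
Definition nbhd A : {set T} := [set v | [exists u in A, e u v]].

Definition edges : {set {set T}} :=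
  [set [set p.1; p.2] | p : T * T & e p.1 p.2].

Definition matching M : bool := (M \subset edges) && trivIset M.

Definition mu : nat := \max_(M : {set {set T}} | matching M) #|M|.

Definition konig_egervary : Prop := alpha + mu = #|T|.

Local Open Scope ring_scope.

(* Differences of cardinals are taken in int: truncated subtraction on nat
   would be wrong. *)
Definition difference A : int := #|A|%:Z - #|nbhd A|%:Z.

(* The maximum of the difference over independent sets; set0 is only the
   witness (an independent set) that the family is nonempty. *)
Definition critical_difference : int :=
  difference [arg max_(S > set0 | independent S) difference S]%O.

Definition deficiency : int := #|T|%:Z - 2 * mu%:Z.

End Graph.

(* Main.v *)
(** A maximum matching is encoded by the involution [f] exchanging matched
    vertices and fixing the [n - 2 mu] unmatched ones. For every vertex set [S],
    [f] maps the matched part of [S] into [N(S)], so that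
    [|S| - |N(S)| <= n - 2 mu]. If [alpha + mu = n], counting shows that [f] maps
    the complement of every maximum independent set [S] into [S]. Hence the
    unmatched vertices lie in the core, and [f] maps [N(core)], which misses every
    such [S], into the core; so the core attains the bound. *)
Require Import Defs.
From mathcomp Require Import all_boot all_order all_algebra.
From mathcomp Require Import zify.

Set Implicit Arguments.
Unset Strict Implicit.
Unset Printing Implicit Defensive.

Import Order.TTheory GRing.Theory Num.Theory.
Local Open Scope ring_scope.

Lemma independentP (T : finType) (e : rel T) (S : {set T}) :
  reflect {in S &, forall x y, ~~ e x y} (independent e S).
Proof.
apply: (iffP forall_inP) => [indS x y xS yS | indS x xS].
  by move/forall_inP: (indS x xS); apply.
by apply/forall_inP => y yS; apply: indS.
Qed.

Lemma independent0 (T : finType) (e : rel T) : independent e set0.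
Proof. by apply/independentP => x y; rewrite inE. Qed.

Lemma independentS (T : finType) (e : rel T) (A B : {set T}) :
  A \subset B -> independent e B -> independent e A.
Proof.
move=> /subsetP sAB /independentP indB; apply/independentP => x y xA yA.
by apply: indB; apply: sAB.
Qed.

Lemma Omega_nonempty (T : finType) (e : rel T) : exists S, S \in Omega e.
Proof.
have [|S indS maxS] := @eq_bigmax_cond _ (independent e) (fun S => #|S|).
  by apply/card_gt0P; exists set0; exact: independent0.
by exists S; rewrite inE /alpha maxS eqxx andbT.
Qed.

Lemma core_independent (T : finType) (e : rel T) : independent e (core e).
Proof.
have [S SO] := Omega_nonempty e.
apply: independentS (bigcap_inf S SO) _.
by move: SO; rewrite inE => /andP[].
Qed.

Lemma maximum_matching (T : finType) (e : rel T) :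
  exists2 M, matching e M & #|M| = mu e.
Proof.
have [|M matchM maxM] := @eq_bigmax_cond _ (matching e) (fun M => #|M|).
  apply/card_gt0P; exists set0; apply/andP; split; first exact: sub0set.
  by apply/trivIsetP => A B; rewrite inE.
by exists M; rewrite // /mu maxM.
Qed.

(** Send each matched vertex to the other end of its matching edge. Disjointness of the edges makes
    this end unique, and since there are no loops the moved vertices form a disjoint union of [#|M|]
    pairs. *)
Lemma matching_involution (T : finType) (e : rel T) (M : {set {set T}}) :
    symmetric e -> irreflexive e -> matching e M ->
  exists f : T -> T,
    [/\ involutive f, forall x, f x != x -> e x (f x)
      & #|[set x | f x != x]| = (2 * #|M|)%N].
Proof.
move=> e_sym e_irr /andP[/subsetP sME tM].
have edge_neq x y : e x y -> x != y.
  by apply: contraTneq => ->; rewrite e_irr.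
have edgeM x y : [set x; y] \in M -> e x y.
  move=> /sME/imsetP[[u v] /=]; rewrite inE /= => euv eq2.
  have uv := edge_neq _ _ euv.
  have : u \in [set x; y] by rewrite eq2 !inE eqxx.
  have : v \in [set x; y] by rewrite eq2 !inE eqxx orbT.
  (* Two of the four cases give [u = v]; the other two give the edge in one of its two
     orientations. *)
  rewrite !inE => /orP[] /eqP vE /orP[] /eqP uE; move: uv euv; rewrite vE uE ?eqxx //.
  by rewrite e_sym.
have uniqM x y z : [set x; y] \in M -> [set x; z] \in M -> y = z.
  move=> My Mz.
  (* Distinct edges of [M] are disjoint, but both of these contain [x]. *)
  have [eq2|/(trivIsetP tM _ _ My Mz)/disjoint_setI0/setP/(_ x)] :=
    eqVneq [set x; y] [set x; z]; last by rewrite !inE !eqxx.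
  have /edge_neq := edgeM _ _ My; rewrite eq_sym => yx.
  have : y \in [set x; z] by rewrite -eq2 !inE eqxx orbT.
  by rewrite !inE (negPf yx) => /eqP.
(* The default value [x] makes the unmatched vertices fixed points. *)
pose f x := odflt x [pick y | [set x; y] \in M].
have fM x y : [set x; y] \in M -> f x = y.
  move=> My; rewrite /f; case: pickP => [z Mz|/(_ y)]; last by rewrite My.
  exact: uniqM Mz My.
have Mf x : f x != x -> [set x; f x] \in M.
  by rewrite /f; case: pickP => [z Mz|_] //=; rewrite eqxx.
exists f; split=> [x|x /Mf/edgeM //|].
  have [fx|/Mf Mx] := eqVneq (f x) x; first by rewrite !fx.
  by apply: fM; rewrite setUC.
have -> : [set x | f x != x] = cover M.
  apply/setP => x; rewrite inE; apply/idP/bigcupP => [/Mf Mx|[A MA xA]].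
    by exists [set x; f x]; rewrite // !inE eqxx.
  have /imsetP[[u v] /=] := sME _ MA; rewrite inE /= => euv AE.
  have uv := edge_neq _ _ euv; rewrite AE in MA xA.
  move: xA; rewrite !inE => /orP[] /eqP ->; first by rewrite (fM _ _ MA) eq_sym.
  by rewrite setUC in MA; rewrite (fM _ _ MA).
rewrite -(eqP tM) mulnC -sum_nat_const; apply: eq_bigr => A /sME/imsetP[[u v] /=].
by rewrite inE /= => /edge_neq uv ->; rewrite cards2 uv.
Qed.

Section Involution.

Variables (T : finType) (e : rel T) (f : T -> T).
Hypotheses (fK : involutive f) (f_edge : forall x, f x != x -> e x (f x)).

Lemma card_le_nbhd_fixed (S : {set T}) :
  (#|S| <= #|nbhd e S| + #|[set x | f x == x]|)%N.
Proof.
(* Split [S] into fixed and moved vertices; [f] injects the moved ones into [nbhd e S]. *)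
rewrite -(cardsID [set x | f x == x] S) addnC leq_add //; last first.
  exact/subset_leq_card/subsetIr.
rewrite -(card_imset _ (inv_inj fK)).
apply/subset_leq_card/subsetP => y /imsetP[x].
rewrite !inE => /andP[fx xS] ->; apply/existsP; exists x.
by rewrite xS f_edge.
Qed.

Hypothesis KE : konig_egervary e.
Hypothesis card_moved : #|[set x | f x != x]| = (2 * mu e)%N.

(** The complement of [S] has [mu e] vertices, so at least half of the [2 * mu e] moved vertices lie
    in [S]. Independence makes [f] inject these into the complement, hence onto it by
    cardinality. *)
Lemma Omega_involution (S : {set T}) (x : T) :
  S \in Omega e -> x \notin S -> f x \in S.
Proof.
rewrite inE => /andP[/independentP indS /eqP cardS] xNS.
pose C := [set x | f x != x].
have cardC : #|C| = (2 * mu e)%N := card_moved.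
have sub : f @: (C :&: S) \subset ~: S.
  apply/subsetP => z /imsetP[y]; rewrite !inE => /andP[fy yS] ->.
  by apply: contraL (f_edge fy) => fyS; apply: indS.
have cardCS : #|~: S| = mu e.
  by have := cardsC S; have := KE; rewrite /konig_egervary; lia.
have leD : (#|C :\: S| <= #|~: S|)%N by rewrite setDE; exact/subset_leq_card/subsetIr.
have eqS : f @: (C :&: S) = ~: S.
  apply/eqP; rewrite eqEcard sub card_imset; last exact: inv_inj.
  by have := cardsID S C; lia.
have : x \in f @: (C :&: S) by rewrite eqS inE.
by case/imsetP => y; rewrite inE => /andP[_ yS] ->; rewrite fK.
Qed.

Lemma core_attains :
  (#|nbhd e (core e)| + #|[set x | f x == x]| <= #|core e|)%N.
Proof.
have nbhdNOmega x S : x \in nbhd e (core e) -> S \in Omega e -> x \notin S.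
  rewrite inE => /exists_inP[u uC eux] SO.
  move: (SO); rewrite inE => /andP[/independentP indS _].
  by apply: contraL eux; apply: indS; apply: (bigcapP uC).
(* If [f x] is fixed then so is [x], yet [x] avoids every maximum independent set while [f x] lies
   in it. *)
have disj : f @: nbhd e (core e) :&: [set x | f x == x] = set0.
  apply/setP => y; rewrite !inE; apply/andP => -[/imsetP[x xN ->]].
  rewrite fK eq_sym => /eqP fx; have [S SO] := Omega_nonempty e.
  have xNS := nbhdNOmega _ _ xN SO.
  by have := Omega_involution SO xNS; rewrite fx (negPf xNS).
(* By disjointness the sum is the size of a union, which lies in every maximum independent set. *)
rewrite -(card_imset _ (inv_inj fK)) -cardsUI disj cards0 addn0.
apply/subset_leq_card/subsetP => y; rewrite inE => yNF; apply/bigcapP => S SO.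
case/orP: yNF => [/imsetP[x xN ->]|].
  exact: Omega_involution (nbhdNOmega _ _ xN SO).
rewrite inE => /eqP fy; apply: contraT => yNS.
by have := Omega_involution SO yNS; rewrite fy (negPf yNS).
Qed.

End Involution.

Theorem theorem5 (T : finType) (e : rel T)
    (e_sym : symmetric e) (e_irr : irreflexive e)
    (KE : konig_egervary e) :
  [/\ critical_difference e = #|core e|%:Z - #|nbhd e (core e)|%:Z,
      #|core e|%:Z - #|nbhd e (core e)|%:Z = (alpha e)%:Z - (mu e)%:Z
    & (alpha e)%:Z - (mu e)%:Z = deficiency e].
Proof.
have [M matchM cardM] := maximum_matching e.
have [f [fK f_edge card_moved]] := matching_involution e_sym e_irr matchM.
rewrite cardM in card_moved.
have upper := card_le_nbhd_fixed fK f_edge.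
have lower := core_attains fK f_edge KE card_moved.
have card_fixed : (#|[set x | f x == x]| + 2 * mu e = #|T|)%N.
  rewrite -card_moved -(cardsC [set x | f x == x]); congr (_ + #|pred_of_set _|)%N.
  by apply/setP => x; rewrite !inE.
have KEn : (alpha e + mu e = #|T|)%N := KE.
split; last by rewrite /deficiency; lia.
  rewrite /critical_difference; case: arg_maxP => [|S indS maxS].
    exact: independent0.
  (* The maximiser [S] does at least as well as the core, and [upper] caps it at the number of fixed
     points, which the core reaches by [lower]. *)
  have := maxS _ (core_independent e); have := upper S.
  by rewrite /difference /=; lia.
by have := upper (core e); lia.
Qed.
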